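(* Let $\delta\in(0,1)$. Consider the Partially Identifiable Best Arm Identification problem, and the following algorithm. Initialize $S\leftarrow[k]$, $r\leftarrow1$. While $|S|>1$: sample each arm $i\in S$ once and produce the estimate $\hat p_{i,r}$ from all $r$ past samples of arm $i$; set $$S\leftarrow\left\{i\in S:\ \hat p_{i,r}\ge\max_{j\in S}\hat p_{j,r}-2\alpha_{r,\,6\delta/(\pi^2kr^2)}\right\};$$ set $r\leftarrow r+1$. Output the only arm left in $S$. Here $\alpha_{r,\delta'}:=\sqrt{c\log(1/\delta')/r}$. With probability at least $1-\delta$, this algorithm outputs the optimal arm $i^*$ after using at most $$O\left(\sum_{i\ne i^*}\frac{1}{\tilde\Delta_i^2}\log\left(\frac{k}{\delta\tilde\Delta_i}\right)\right)$$ samples.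
   Context: Partially Identifiable Best Arm Identification (PIBAI). There are $k\ge2$ arms, $[k]=\{1,\dots,k\}$. For each arm $i$ there is a family of distributions $\{D_i(p_i,G)\}_{G\in\mathcal{G}}$, where $p_i\in\mathbb{R}$ is the (unknown) quality of arm $i$ and $G$ is a nuisance parameter in an abstract space $\mathcal{G}$. Let $i^*=\arg\max_{i}p_i$ be the optimal arm. In each iteration $t$ an algorithm chooses an arm $I_t$ and receives a sample from $D_{I_t}(p_{I_t},G_t)$ for some unknown, possibly varying $G_t\in\mathcal{G}$; it eventually outputs an arm. There are non-negative numbers $U_1,\dots,U_k$ (unavoidable biases) such that (i) even from infinitely many independent samples $X_t\sim D_i(p_i,G_t)$, $p_i$ cannot be estimated more precisely than the region $[p_i-U_i,p_i+U_i]$; and (ii) there is an estimator that, for any $\alpha>0$ and $\delta\in(0,1)$, uses $n_{\alpha,\delta}=O(\alpha^{-2}\log\frac1\delta)$ samples of arm $i$ to output an estimate $\hat p_i$ with $$\mathbb{P}\big(\hat p_i\in[p_i-(U_i+\alpha),\,p_i+(U_i+\alpha)]\big)\ge1-\delta.$$ The constant $c$ is a universal constant with $n_{\alpha,\delta}\le c\,\alpha^{-2}\log\frac1\delta$ for all $\alpha>0,\delta\in(0,1)$. Accordingly, the estimate $\hat p_{i,r}$ computed from $r$ samples of arm $i$ is within $U_i+\alpha_{r,\delta'}$ of $p_i$ with probability at least $1-\delta'$, for $\delta'=6\delta/(\pi^2kr^2)$. The effective gaps are $\tilde\Delta_i=(p_{i^*}-U_{i^*})-(p_i+U_i)$; it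 is assumed throughout that $\tilde\Delta_i>0$ for each $i\ne i^*$.
   Formalization: For large effective gaps the stated sample bound is zero or negative, though every arm is sampled at least once; the theorem proved replaces each summand by its maximum with 1, and gives the literal bound when all effective gaps are at most 1. *)

(* Defs.v *)
From HB Require Import structures.
From mathcomp Require Export all_boot all_order all_algebra.
From mathcomp Require Export all_classical all_reals all_analysis.

Set Implicit Arguments.
Unset Strict Implicit.
Unset Printing Implicit Defensive.

Import Order.TTheory GRing.Theory Num.Theory.

Local Open Scope ring_scope.

(* Independent samples [X 0], [X 1], ... (as random elements of the observation
   space [O]) where [X s] has law [mu s]; the laws need not be identical. The
   product rule over initial segments gives it over every finite set of indices,
   since some of the [B s] may be the whole space. *)
Definition independent_samples (R : realType)
    (d : measure_display) (T : measurableType d) (P : probability T R)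
    (dO : measure_display) (O : measurableType dO)
    (X : nat -> {mfun T >-> O}) (mu : nat -> probability O R) : Prop :=
  (forall (s : nat) (B : set O), measurable B ->
     distribution P (X s) B = mu s B) /\
  (forall (n : nat) (B : nat -> set O), (forall s, measurable (B s)) ->
     P (\bigcap_(s in [set s | (s < n)%N]) (X s @^-1` B s))%classic
     = (\prod_(s < n) P (X s @^-1` B s)%classic)%E).

Definition first_samples (T O : Type) (X : nat -> T -> O) (r : nat) (w : T)
  : r.-tuple O := [tuple X s w | s < r].

(* [Dq G] is the law of a sample when the nuisance parameter is [G] and the
   quality is [q]: whatever the sequence of nuisance parameters, the estimator
   [e], fed with [r] independent samples, is within [rad] of [q] with
   probability at least [1 - beta]. *)
Definition accurate_estimator (R : realType)
    (dO : measure_display) (O : measurableType dO) (N : Type)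
    (Dq : N -> probability O R) (q : R)
    (r : nat) (e : {mfun r.-tuple O >-> R}) (rad beta : R) : Prop :=
  forall (d : measure_display) (T : measurableType d) (P : probability T R)
    (G : nat -> N) (X : nat -> {mfun T >-> O}),
  independent_samples P X (fun s => Dq (G s)) ->
  ((1 - beta)%:E <=
     P [set w | (`| e (first_samples X r w) - q | <= rad)%R]%classic)%E.

Definition alpha (R : realType) (c : R) (r : nat) (beta : R) : R :=
  Num.sqrt (c * ln (1 / beta) / r%:R).

Definition round_level (R : realType) (k : nat) (delta : R) (r : nat) : R :=
  6 * delta / (pi ^+ 2 * k%:R * r%:R ^+ 2).

Section SuccessiveElimination.
Variables (R : realType) (k : nat).

(* [phat i r] is the estimate of arm [i] computed from its first [r] samples and
   [thr r] the elimination threshold of round [r], with [r >= 1]. *)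
Variables (phat : 'I_k -> nat -> R) (thr : nat -> R).

(* Since [i \in S], using [phat i r] as the starting value of the maximum makes
   it exactly the maximum over [S]. *)
Definition eliminate (r : nat) (S : {set 'I_k}) : {set 'I_k} :=
  [set i in S |
     \big[Num.max/phat i r]_(j in S) phat j r - thr r <= phat i r]%SET.

(* Value of [S] after [n] passes through the body of the loop, the [n]-th pass
   being round [r = n]. Meaningful as long as the guard [1 < #|S|] held before
   each of these passes, which [outputs_within] demands. *)
Fixpoint surviving (n : nat) : {set 'I_k} :=
  if n is m.+1 then eliminate m.+1 (surviving m) else [set: 'I_k]%SET.

(* The loop exits after exactly [n] passes with [i] as the only arm left, and
   the number of samples, one per arm of [S] in each pass, is at most [bound]. *)
Definition outputs_within (i : 'I_k) (bound : R) : Prop :=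
  exists n : nat,
    [/\ forall m, (m < n)%N -> (1 < #|surviving m|)%N,
        surviving n = [set i]%SET
      & (\sum_(m < n) #|surviving m|)%:R <= bound].

End SuccessiveElimination.

(* The event that the algorithm outputs [i] within [bound] samples; the [s]-th
   sample drawn from arm [j] is [X j s], counting from [0]. *)
Definition algorithm_event (R : realType) (k : nat) (c delta : R)
    (T O : Type) (est : 'I_k -> forall r : nat, r.-tuple O -> R)
    (X : 'I_k -> nat -> T -> O) (i : 'I_k) (bound : R) : set T :=
  [set w | outputs_within
             (fun j r => est j r (first_samples (X j) r w))
             (fun r => 2 * alpha c r (round_level k delta r))
             i bound]%classic.

(* Measurability is part of the claim because a [probability] is a total
   function on sets, unconstrained outside the sigma-algebra. *)
Definition holds_with_probability (R : realType)
    (d : measure_display) (T : measurableType d) (P : probability T R)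
    (x : R) (E : set T) : Prop :=
  measurable E /\ (x%:E <= P E)%E.

Definition effective_gap (R : realType) (k : nat) (p U : 'I_k -> R)
    (istar i : 'I_k) : R :=
  (p istar - U istar) - (p i + U i).

(* Each arm is sampled at least once, whereas this quantity tends to [0] and even
   becomes negative as [gap] grows: as a bound up to a constant factor it has to
   be capped below by [1] unless the gaps are bounded, e.g. by [1]. *)
Definition arm_complexity (R : realType) (k : nat) (delta gap : R) : R :=
  1 / gap ^+ 2 * ln (k%:R / (delta * gap)).

(* Main.v *)
(* On the event that every estimate [phat i r] is within [U i + alpha_r] of
   [p i], the arm [istar] is never eliminated, and a suboptimal arm [i] is
   eliminated at the latest in the first round [r] with [4 alpha_r < gap i],
   hence after [O(gap^-2 log (k / (delta gap)))] rounds. While [S] has at least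
   two elements, [#|S| <= 2 #|S \ istar|], so that the samples of [istar] are
   paid for by those of the other arms. The algorithm thus stops within a fixed
   number of rounds, and a finite union bound over arms and rounds suffices; it
   needs [\sum_(r <= n) r^-2 <= pi^2 / 6]. That inequality is obtained by
   iterating [sin(x)^-2 = (sin(x/2)^-2 + sin((x + pi)/2)^-2) / 4] from
   [x = pi / 2], which gives [\sum_(k < 2^n) (2k + 1)^-2 <= pi^2 / 8]. *)
Require Import Defs.
From mathcomp Require Import measurable_realfun ring lra zify.

Set Implicit Arguments.
Unset Strict Implicit.
Unset Printing Implicit Defensive.

Import Order.TTheory GRing.Theory Num.Theory.
Import numFieldNormedType.Exports.
Local Open Scope ring_scope.

(** * The bound [\sum r^-2 <= pi^2 / 6], through inverse squared sines *)

Lemma sin_le_id (R : realType) (x : R) : 0 <= x -> sin x <= x.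
Proof.
rewrite le_eqVlt => /predU1P[<-|x0]; first by rewrite sin0.
have [y _] : exists2 y, y \in `]0, x[ & sin x - sin 0 = cos y * (x - 0).
  by apply: MVT => //; apply: continuous_subspaceT; exact: continuous_sin.
rewrite sin0 !subr0 => ->; rewrite -[leRHS]mul1r ler_pM2r//; exact: cos_le1.
Qed.

(** With [s], [a] the sine and cosine of [x / 2]: [sin x = 2 s a], [sin ((x + pi) / 2) = a], and
    [1/s^2 + 1/a^2 = 1/(s a)^2]. *)
Lemma inv_sin_sqr_half (R : realType) (x : R) : sin x != 0 ->
  (sin x ^+ 2)^-1
  = 4^-1 * ((sin (x / 2) ^+ 2)^-1 + (sin ((x + pi) / 2) ^+ 2)^-1).
Proof.
have -> : (x + pi) / 2 = x / 2 + pi / 2 by field.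
rewrite sinDpihalf {1 2}(_ : x = x / 2 *+ 2); last by rewrite mulr2n; field.
rewrite sin_mulr2n mulr2n.
have := cos2Dsin2 (x / 2); set s := sin _; set a := cos _ => sa h.
have [s0 a0] : s != 0 /\ a != 0.
  by split; apply: contraNneq h => ->; rewrite ?mulr0 ?mul0r addr0.
have -> : (s ^+ 2)^-1 + (a ^+ 2)^-1 = (a ^+ 2 + s ^+ 2) / (s ^+ 2 * a ^+ 2).
  by field; rewrite s0 a0.
by rewrite sa; field; rewrite s0 a0.
Qed.

(** For [k < 2 ^ n], the angles reached from [pi / 2] by [n] steps [x -> x / 2] or
    [x -> (x + pi) / 2]. *)
Definition odd_angle (R : realType) (n k : nat) : R :=
  (2 * k + 1)%:R * pi / 2 ^+ n.+1.

Lemma odd_angle_gt0 (R : realType) n k : 0 < odd_angle R n k.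
Proof. by rewrite divr_gt0 ?exprn_gt0 ?mulr_gt0 ?pi_gt0 ?ltr0n ?addn1. Qed.

Lemma odd_angleC (R : realType) n k : (k < 2 ^ n)%N ->
  odd_angle R n (2 ^ n - k.+1) = pi - odd_angle R n k.
Proof.
move=> kn; rewrite /odd_angle 2!natrD 2!natrM natrB// natrX exprS -natr1.
by field; rewrite expf_neq0.
Qed.

Lemma sin_odd_angle_gt0 (R : realType) n k : (k < 2 ^ n)%N ->
  0 < sin (odd_angle R n k).
Proof.
move=> kn; apply: sin_gt0_pi; rewrite odd_angle_gt0/= -subr_gt0.
by rewrite -odd_angleC// odd_angle_gt0.
Qed.

(** Halving sends angle [k] of level [n] to the angles [k] and [k + 2 ^ n] of level [n.+1], so each
    level multiplies the sum by 4. *)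
Lemma sum_inv_sin_sqr (R : realType) n :
  \sum_(0 <= k < 2 ^ n) (sin (odd_angle R n k) ^+ 2)^-1 = 4 ^+ n.
Proof.
elim: n => [|n IHn].
  rewrite big_nat1 /odd_angle muln0 add0n mul1r expr1 sin_pihalf.
  by rewrite expr1n invr1 expr0.
rewrite exprS -IHn (big_cat_nat (n := 2 ^ n)) ?leq_exp2l//=.
have e : (2 ^ n.+1 = 2 ^ n + 2 ^ n)%N by rewrite expnS mul2n addnn.
rewrite -{2}[(2 ^ n)%N]add0n big_addn e addnK -big_split/= mulr_sumr.
apply: eq_big_nat => k /andP[_ kn].
rewrite (inv_sin_sqr_half (lt0r_neq0 (sin_odd_angle_gt0 R kn))).
rewrite mulrA divff ?mul1r; last by rewrite pnatr_eq0.
congr ((sin _ ^+ 2)^-1 + (sin _ ^+ 2)^-1).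
  by rewrite /odd_angle [in LHS]exprS; field; rewrite expf_neq0.
rewrite /odd_angle (_ : 2 * (k + 2 ^ n) + 1 = (2 * k + 1) + 2 * 2 ^ n)%N;
  last first.
  by rewrite mulnDr addnAC.
rewrite natrD [(2 * 2 ^ n)%:R]natrM natrX !exprS.
by field; rewrite expf_neq0.
Qed.

(* [sin y <= y] on the first half of the angles, [sin y <= pi - y] beyond. *)
Lemma sum_inv_odd_sqr (R : realType) n :
  \sum_(0 <= k < 2 ^ n) ((2 * k + 1)%:R ^+ 2)^-1 <= pi ^+ 2 / 8 :> R.
Proof.
have pi0 := @pi_gt0 R; have pin0 := lt0r_neq0 pi0.
have angle m k : (odd_angle R m k ^+ 2)^-1
    = 4 * 4 ^+ m / pi ^+ 2 * ((2 * k + 1)%:R ^+ 2)^-1.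
  have field_id (a q t : R) : a != 0 -> q != 0 -> t != 0 ->
      ((a * q / (2 * t)) ^+ 2)^-1 = 4 * t ^+ 2 / q ^+ 2 * (a ^+ 2)^-1.
    by move=> a0 q0 t0; field; rewrite q0 a0 t0.
  rewrite /odd_angle [2 ^+ m.+1]exprS field_id ?expf_neq0 ?pnatr_eq0 ?addn1//.
  by rewrite exprAC (_ : 2 ^+ 2 = 4 :> R)//; ring.
have le_sin m k : (k < 2 ^ m)%N ->
    (odd_angle R m k ^+ 2)^-1 <= (sin (odd_angle R m k) ^+ 2)^-1.
  move=> km; rewrite lef_pV2 ?posrE ?exprn_gt0 ?odd_angle_gt0
    ?sin_odd_angle_gt0//.
  by apply: lerXn2r;
    rewrite ?nnegrE ?sin_le_id// ltW ?odd_angle_gt0 ?sin_odd_angle_gt0.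
have e : (2 ^ n.+1 = 2 ^ n + 2 ^ n)%N by rewrite expnS mul2n addnn.
have nl k : (k < 2 ^ n -> k < 2 ^ n.+1)%N.
  by move=> kn; rewrite e ltn_addr.
have : 2 * \sum_(0 <= k < 2 ^ n) (odd_angle R n.+1 k ^+ 2)^-1 <= 4 ^+ n.+1.
  rewrite -sum_inv_sin_sqr [leRHS](big_cat_nat (n := 2 ^ n)) ?leq_exp2l//=.
  rewrite mulr_natl mulr2n lerD//.
    by apply: ler_sum_nat => k /andP[_ kn]; exact/le_sin/nl.
  (* Reversed, the upper half consists of the angles [pi - odd_angle R n.+1 k], whose sines are
     those of the lower half. *)
  rewrite -{2}[(2 ^ n)%N]add0n big_addn e addnK [leRHS]big_nat_rev/= add0n.
  apply: ler_sum_nat => k /andP[_ kn].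
  have -> : (2 ^ n - k.+1 + 2 ^ n = 2 ^ n.+1 - k.+1)%N by rewrite e addnBAC.
  rewrite odd_angleC ?nl// sinB sinpi cospi mul0r sub0r mulN1r opprK.
  exact/le_sin/nl.
have solve (q S N : R) : 0 < q -> 0 < N ->
    2 * (4 * N / q ^+ 2 * S) <= N -> S <= q ^+ 2 / 8.
  move=> q0 N0; rewrite (_ : 2 * _ = 8 * S / q ^+ 2 * N); last first.
    by field; exact: lt0r_neq0.
  rewrite ger_pMl// ler_pdivrMr ?exprn_gt0// mul1r => h.
  by rewrite ler_pdivlMr//; lra.
rewrite (eq_bigr _ (fun k _ => angle n.+1 k)) -mulr_sumr => /solve; apply=> //.
Qed.

(** Odd and even terms give [S (2 m) = odd part + S m / 4]; with [S m <= S (2 m)] this yields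
    [3/4 * S m <= pi^2 / 8]. The choice [m = 2 ^ n >= n] matches the bound on odd terms. *)
Lemma sum_inv_sqr_le (R : realType) n :
  \sum_(1 <= r < n.+1) (r%:R ^+ 2)^-1 <= pi ^+ 2 / 6 :> R.
Proof.
pose S m : R := \sum_(1 <= r < m.+1) (r%:R ^+ 2)^-1.
have Sle m m' : (m <= m')%N -> S m <= S m'.
  move=> mm'; rewrite /S [leRHS](big_cat_nat (n := m.+1))//=.
  by rewrite lerDl sumr_ge0// => i _; rewrite invr_ge0 exprn_ge0.
have Sdouble m : S (m + m)%N
    = \sum_(0 <= k < m) ((2 * k + 1)%:R ^+ 2)^-1 + 4^-1 * S m.
  rewrite /S big_add1/= big_add1/=.
  elim: m => [|m IH]; first by rewrite !big_geq// mulr0 addr0.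
  rewrite addSn addnS !big_nat_recr//= IH.
  have -> : (m + m).+2 = (2 * m.+1)%N by rewrite mul2n -addnn addSn addnS.
  have -> : (m + m).+1 = (2 * m + 1)%N by rewrite mul2n -addnn addn1.
  have -> : ((2 * m.+1)%:R ^+ 2)^-1 = 4^-1 * (m.+1%:R ^+ 2)^-1 :> R.
    by rewrite natrM exprMn invfM; congr (_^-1 * _); ring.
  by ring.
have h := Sdouble (2 ^ n)%N; have odd_le := sum_inv_odd_sqr R n.
have le1 := Sle _ _ (leq_addr (2 ^ n) (2 ^ n)).
have le2 : S n <= S (2 ^ n)%N by apply/Sle/ltnW/ltn_expl.
rewrite -/(S n).
rewrite h in le1.
by lra.
Qed.

(** * The elimination loop when all estimates are accurate *)

(** A nonnegative threshold makes the starting value [phat i r] of the maximum harmless, so the test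
    splits arm by arm. *)
Lemma in_eliminate (R : realType) (k : nat) (phat : 'I_k -> nat -> R)
    (thr : nat -> R) r (S : {set 'I_k}) i : 0 <= thr r ->
  (i \in eliminate phat thr r S)
  = (i \in S) && [forall (j | j \in S), phat j r - thr r <= phat i r].
Proof.
move=> thr0; rewrite inE lerBlDr; congr andb; apply/idP/forall_inP.
  by move=> /bigmax_leP[_ h] j /h; rewrite lerBlDr.
by move=> h; apply/bigmax_leP; rewrite lerDl; split=> // j /h; rewrite lerBlDr.
Qed.

Lemma surviving_antitone (R : realType) (k : nat) (phat : 'I_k -> nat -> R)
    (thr : nat -> R) m n :
  (m <= n)%N -> surviving phat thr n \subset surviving phat thr m.
Proof.
move=> /subnKC <-; elim: (n - m)%N => [|l IHl]; first by rewrite addn0.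
rewrite addnS; apply: fintype.subset_trans IHl.
by apply/fintype.subsetP => i; rewrite inE => /andP[].
Qed.

Lemma sum_ltn_le n t : (\sum_(m < n) (m < t) <= t)%N.
Proof.
suff -> : (\sum_(m < n) (m < t) = minn n t)%N by exact: geq_minr.
by elim: n => [|n IHn]; rewrite ?big_ord0 ?big_ord_recr ?min0n//= IHn; lia.
Qed.

(** Deterministic core: a suboptimal arm [i] is out by the end of round [tau i]. Accuracy is asked
    only up to the horizon [n0], which keeps the later union bound finite. *)
Lemma outputs_within_accurate (R : realType) (k : nat)
    (phat : 'I_k -> nat -> R) (a : nat -> R) (p U : 'I_k -> R) (istar : 'I_k)
    (tau : 'I_k -> nat) (n0 : nat) :
  (forall r, 0 <= a r) ->
  (forall i, i != istar -> 0 < effective_gap p U istar i) ->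
  (forall i, (0 < tau i <= n0)%N) ->
  (forall i, i != istar -> 4 * a (tau i) < effective_gap p U istar i) ->
  (forall i r, (0 < r <= n0)%N -> `|phat i r - p i| <= U i + a r) ->
  outputs_within phat (fun r => 2 * a r) istar
    (2 * \sum_(i < k | i != istar) (tau i)%:R).
Proof.
move=> a0 gap0 tau_n0 tau_gap good.
set S := surviving phat (fun r => 2 * a r).
have thr0 r : 0 <= 2 * a r by rewrite mulr_ge0.
have istarS m : (m <= n0)%N -> istar \in S m.
  elim: m => [_|m IHm m_n0]; first by rewrite inE.
  rewrite in_eliminate// IHm ?(ltnW m_n0)//=; apply/forall_inP => j _.
  have [->|jistar] := eqVneq j istar; first by have := a0 m.+1; lra.
  (* Here [phat j <= p j + U j + a < p istar - U istar + a <= phat istar + 2 a]. *)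
  have := good j m.+1 m_n0; have := good istar m.+1 m_n0.
  have := gap0 _ jistar; rewrite /effective_gap !ler_norml.
  by move=> ? /andP[? ?] /andP[? ?]; lra.
have goneS i m : i != istar -> (tau i <= m)%N -> i \notin S m.
  move=> iistar tau_m;
    apply: contraTN isT => /(fintype.subsetP (surviving_antitone _ _ tau_m)).
  have /andP[t0 tn0] := tau_n0 i.
  rewrite -{1}(prednK t0) in_eliminate// prednK// => /andP[_ /forall_inP].
  move=> /(_ istar (istarS _ (leq_trans (leq_pred _) tn0))).
  (* In round [tau i], [istar] is still present and leads by at least [gap - 2 a > 2 a]. *)
  have := good i _ (tau_n0 i); have := good istar _ (tau_n0 i).
  have := tau_gap _ iistar; rewrite /effective_gap !ler_norml.
  by move=> ? /andP[? ?] /andP[? ?] ?; exfalso; lra.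
have singleS m : (m <= n0)%N -> (#|S m| <= 1)%N -> S m = [set istar]%SET.
  move=> mn0 cS; apply/esym/eqP.
  by rewrite eqEcard finset.sub1set istarS//= cards1.
have Sn0 : (#|S n0| <= 1)%N.
  rewrite (_ : S n0 = [set istar]%SET) ?cards1//.
  apply/setP => i; rewrite finset.in_set1; have [->|iistar] := eqVneq i istar.
    exact: istarS.
  by apply/negbTE/goneS => //; have /andP[] := tau_n0 i.
have exS : exists n, (#|S n| <= 1)%N by exists n0.
(* The first [n] with at most one arm left is the exit time; minimality supplies the loop guard. *)
case: (ex_minnP exS) => n Sn nmin; have n_n0 := nmin _ Sn0.
have Sgt1 m : (m < n)%N -> (1 < #|S m|)%N.
  by move=> mn; rewrite ltnNge; apply: contraTN mn => /nmin; rewrite -leqNgt.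
exists n; split=> //; first exact: singleS.
rewrite -natr_sum -natrM ler_nat.
apply: (@leq_trans (\sum_(m < n) 2 * \sum_(i < k | i != istar) (i \in S m))).
  apply: leq_sum => m _; have := Sgt1 _ (ltn_ord m).
  have -> : #|S m| = (1 + \sum_(i < k | i != istar) (i \in S m))%N; last by lia.
  rewrite -sum1_card big_mkcond/= (bigD1 istar)//= istarS.
    by congr addn; apply: eq_bigr => i _; case: (i \in _).
  exact: leq_trans (ltnW (ltn_ord m)) n_n0.
(* Swapping the sums counts, for each suboptimal arm, the passes that still sample it: at most
   [tau i]. *)
rewrite -big_distrr/= leq_mul2l/= exchange_big/=.
apply: leq_sum => i iistar; apply: leq_trans (sum_ltn_le n (tau i)).
apply: leq_sum => m _; case: (ltnP m (tau i)) => [_|]; first exact: leq_b1.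
by move=> /(goneS _ _ iistar)/negbTE ->.
Qed.

(** * Rounds needed to bring the confidence radius below a quarter of the gap *)

Lemma ln_le_div (R : realType) (a x : R) : 0 < a -> 0 < x ->
  ln x <= x / a + ln a.
Proof.
move=> a0 x0; rewrite -[in leLHS](divfK (lt0r_neq0 a0) x).
rewrite lnM ?posrE ?divr_gt0// lerD2r.
by rewrite ltW// ln_sublinear// divr_gt0.
Qed.

Lemma ln2_ge_half (R : realType) : 1 / 2 <= ln 2 :> R.
Proof.
have /(_ (- (1 / 2) : R)) := @le_ln1Dx R.
rewrite (_ : 1 + - (1 / 2) = 2^-1); last by field.
by rewrite lnV ?posrE// => /(_ ltac:(lra)); lra.
Qed.

(** With [x = r * gap^2] and [L = ln (k / delta)], the claim squared and multiplied by [r] reads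
    [16 c (ln (pi^2 / 6) + L + 2 ln r) < x]. *)
Lemma alpha_lt_gap (R : realType) (c : R) (hc : 0 < c) :
  exists2 K : R, 1 <= K &
  forall (k r : nat) (delta gap : R), (2 <= k)%N -> 0 < delta < 1 -> 0 < gap ->
    K * Num.max 1 (arm_complexity k delta gap) <= r%:R ->
    4 * alpha c r (round_level k delta r) < gap.
Proof.
(* [2 ln (64 c)] is the price of absorbing [ln r]. In [K], [32 c] doubles [16 c] because that
   absorption uses half of [x]; [2 * B + 4] comes from [key], and [+ 1] gives strictness and
   [1 <= K]. *)
pose B : R := Num.max 1 (ln (pi ^+ 2 / 6) + 2 * ln (64 * c)).
have B1 : 1 <= B by rewrite le_max lexx.
pose K := 32 * c * (2 * B + 4) + 1.
have cB : 0 <= 32 * c * (2 * B + 4) by rewrite !mulr_ge0//; lra.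
exists K; first by rewrite /K; lra.
move=> k r delta gap k2 /andP[d0 d1] g0 Kr.
pose M := Num.max 1 (arm_complexity k delta gap).
have M1 : 1 <= M by rewrite le_max lexx.
have r0 : 0 < r%:R :> R.
  by apply: lt_le_trans Kr; rewrite mulr_gt0//;
    [rewrite /K; lra|exact: lt_le_trans ltr01 M1].
have k0 : 0 < k%:R :> R by rewrite ltr0n; lia.
have k2R : 2 <= k%:R :> R by rewrite ler_nat.
pose L : R := ln (k%:R / delta).
pose Lam : R := ln (k%:R / (delta * gap)).
have LamE : Lam = L - ln gap.
  rewrite /Lam /L invfM mulrA ln_div ?posrE//.
  by rewrite divr_gt0.
have Lln2 : ln 2 <= L.
  by rewrite ler_ln ?posrE ?divr_gt0// ler_pdivlMr//; apply: le_trans k2R; lra.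
have Lhalf : 1 / 2 <= L := le_trans (ln2_ge_half R) Lln2.
pose x := r%:R * gap ^+ 2.
have g2 : 0 < gap ^+ 2 by rewrite exprn_gt0.
have x0 : 0 < x by rewrite mulr_gt0.
have xM : K * (gap ^+ 2 * M) <= x by rewrite mulrCA /x [leRHS]mulrC ler_pM2l.
have gM1 : gap ^+ 2 <= gap ^+ 2 * M by rewrite ler_peMr// ltW.
have gM2 : Lam <= gap ^+ 2 * M.
  rewrite mulrC -ler_pdivrMr// /M le_max /arm_complexity -/Lam.
  by rewrite mul1r mulrC lexx orbT.
set W := gap ^+ 2 * M in xM gM1 gM2.
(* If [gap >= 1], then [W >= 1] and [L = Lam + ln gap]. Otherwise [- ln gap = Lam - L] and
   [Lam >= 1/2], hence [W >= 1/2] and [B <= 2 B W]. *)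
have key : B + L - 4 * ln gap <= (2 * B + 4) * W.
  have [g1|g1] := lerP 1 gap.
    have : 1 <= W by apply: le_trans gM1; rewrite exprn_ege1.
    have := ln_ge0 g1; nra.
  have := ln_lt0 (x := gap); rewrite g0 g1 => /(_ isT) lng; nra.
have W0 : 0 < W := lt_le_trans g2 gM1.
have xlow : 32 * c * (B + L - 4 * ln gap) < x.
  apply: lt_le_trans xM; rewrite /K.
  have : 32 * c * (B + L - 4 * ln gap) <= 32 * c * ((2 * B + 4) * W).
    by rewrite ler_pM2l// mulr_gt0.
  lra.
(* [ln r], which comes from the confidence level, is absorbed into half of [x]. *)
have lnr : ln r%:R = ln x - 2 * ln gap.
  by rewrite /x lnM ?posrE// lnXn// mulr_natl; lra.
have lnx : 32 * c * ln x <= x / 2 + 32 * c * ln (64 * c).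
  have := @ln_le_div R (64 * c) x; rewrite mulr_gt0// => /(_ isT x0).
  rewrite -(ler_pM2l (_ : 0 < 32 * c)) ?mulr_gt0// mulrDr.
  rewrite (_ : 32 * c * (x / (64 * c)) = x / 2)//.
  by field; rewrite gt_eqF.
have Bge : ln (pi ^+ 2 / 6) + 2 * ln (64 * c) <= B by rewrite le_max lexx orbT.
have lev : ln (1 / round_level k delta r) = ln (pi ^+ 2 / 6) + L + 2 * ln r%:R.
  have level_inv (q a b t : R) : q != 0 -> a != 0 -> b != 0 -> t != 0 ->
      1 / (6 * a / (q ^+ 2 * b * t ^+ 2)) = q ^+ 2 / 6 * (b / a) * t ^+ 2.
    by move=> q0 a0 b0 t0; field; rewrite q0 a0 b0 t0.
  rewrite /round_level level_inv ?lt0r_neq0 ?pi_gt0// /L.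
  rewrite lnM ?posrE ?mulr_gt0 ?invr_gt0 ?exprn_gt0 ?pi_gt0// lnXn//.
  rewrite [2 * _]mulr_natl.
  by rewrite lnM ?posrE ?mulr_gt0 ?invr_gt0 ?exprn_gt0 ?pi_gt0.
rewrite /alpha lev; move: Bge; generalize (ln (pi ^+ 2 / 6) : R) => b Bge.
set Y := c * _ / _.
(* The [ln x] term costs [x / 2] plus a constant held in [B]; [xlow] keeps the rest below
   [x / 2]. *)
have : 16 * Y < gap ^+ 2.
  rewrite /Y mulrA ltr_pdivrMr// [gap ^+ 2 * _]mulrC -/x lnr.
  have : 16 * c * (b + 2 * ln (64 * c)) <= 16 * c * B.
    by rewrite ler_pM2l ?mulr_gt0.
  by move: lnx xlow; lra.
move=> Yg.
have : Num.sqrt Y < Num.sqrt ((gap / 4) ^+ 2).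
  rewrite ltr_sqrt ?exprn_gt0 ?divr_gt0//.
  by rewrite expr_div_n (_ : 4 ^+ 2 = 16 :> R); [lra | ring].
by rewrite sqrtr_sqr gtr0_norm ?divr_gt0//; lra.
Qed.

(** * Measurability of the success event *)

Local Open Scope classical_set_scope.

(** Splits along the countably many values [a] of [f], where [F (f w)] is the fixed [F a]. This
    carries measurability through a recursion whose state is random but discrete. *)
Lemma measurable_preimage_bind d (T : measurableType d) (A : countType)
    (B : Type) (f : T -> A) (F : A -> T -> B) (Y : set B) :
  (forall Z, measurable (f @^-1` Z)) ->
  (forall a, measurable (F a @^-1` Y)) ->
  measurable ((fun w => F (f w) w) @^-1` Y).
Proof.
move=> mf mF.
have -> : (fun w => F (f w) w) @^-1` Y
    = \bigcup_a (f @^-1` [set a] `&` F a @^-1` Y).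
  by apply/seteqP; split=> [w Yw|w [a _ [/= <-]]//]; exists (f w).
apply: countable_bigcupT_measurable => [|a]; first exact: countableP.
exact: measurableI.
Qed.

Lemma measurable_bigmaxr d (T : measurableType d) (R : realType) (I : Type)
    (s : seq I) (Q : pred I) (f : T -> R) (g : I -> T -> R) :
  measurable_fun setT f -> (forall i, measurable_fun setT (g i)) ->
  measurable_fun setT (fun w => \big[Num.max/f w]_(i <- s | Q i) g i w).
Proof.
move=> mf mg; elim: s => [|i s IHs].
  by under eq_fun do rewrite big_nil.
under eq_fun do rewrite big_cons.
by case: (Q i) => //; exact: measurable_maxr.
Qed.

(** The new set is determined by the finitely many bits [keep i], so the preimage is a finite union
    of finite intersections. *)
Lemma measurable_eliminate d (T : measurableType d) (R : realType) (k : nat)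
    (phat : T -> 'I_k -> nat -> R) (thr : nat -> R) r (S : {set 'I_k})
    (Y : set {set 'I_k}) :
  (forall i r, measurable_fun setT (fun w => phat w i r)) ->
  measurable ((fun w => eliminate (phat w) thr r S) @^-1` Y).
Proof.
move=> mphat; pose keep i w := i \in eliminate (phat w) thr r S.
have mkeep i b : measurable (keep i @^-1` [set b]).
  rewrite -[X in measurable X]setTI;
    suff : measurable_fun setT (keep i) by apply.
  rewrite (_ : keep i = fun w => (i \in S) &&
    (\big[Num.max/phat w i r]_(j in S) phat w j r - thr r <= phat w i r));
      last first.
    by apply: funext => w; rewrite /keep inE.
  apply: measurable_and => //; apply: measurable_fun_ler => //.
  by apply: measurable_funB => //; exact: measurable_bigmaxr.
have -> : (fun w => eliminate (phat w) thr r S) @^-1` Y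
    = \bigcup_(A in Y)
        \bigcap_(i in [set: 'I_k]) (keep i @^-1` [set (i \in A)]).
  apply/seteqP; split=> [w Yw|w [A YA h] /=];
    first by exists (eliminate (phat w) thr r S).
  by rewrite (_ : eliminate _ _ _ _ = A)//; apply/setP => i; exact: h.
apply: fin_bigcup_measurable => [|A _]; first exact: finite_finset.
by apply: fin_bigcap_measurable => [|i _]; [exact: finite_finset|exact: mkeep].
Qed.

Lemma measurable_surviving d (T : measurableType d) (R : realType) (k : nat)
    (phat : T -> 'I_k -> nat -> R) (thr : nat -> R) m (Y : set {set 'I_k}) :
  (forall i r, measurable_fun setT (fun w => phat w i r)) ->
  measurable ((fun w => surviving (phat w) thr m) @^-1` Y).
Proof.
move=> mphat; elim: m Y => [|m IHm] Y /=.
  by rewrite preimage_cst; case: ifP.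
apply: (measurable_preimage_bind (f := fun w => surviving (phat w) thr m)
  (F := fun S w => eliminate (phat w) thr m.+1 S)) => // S.
exact: measurable_eliminate.
Qed.

(** A countable union over the exit time [n]; for fixed [n] only the discrete sets [S m] and their
    total size are constrained. *)
Lemma measurable_outputs_within d (T : measurableType d) (R : realType)
    (k : nat) (phat : T -> 'I_k -> nat -> R) (thr : nat -> R) (i : 'I_k)
    (bound : R) :
  (forall i r, measurable_fun setT (fun w => phat w i r)) ->
  measurable [set w | outputs_within (phat w) thr i bound].
Proof.
move=> mphat; pose S m w := surviving (phat w) thr m.
have mS m Y : measurable (S m @^-1` Y) by exact: measurable_surviving.
have msum n Y : measurable ((fun w => \sum_(m < n) #|S m w|)%N @^-1` Y).
  elim: n Y => [|n IHn] Y.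
    by under eq_fun do rewrite big_ord0; rewrite preimage_cst; case: ifP.
  under eq_fun do rewrite big_ord_recr.
  apply: (measurable_preimage_bind (f := fun w => (\sum_(m < n) #|S m w|)%N)
    (F := fun s w => (s + #|S n w|)%N)) => // s.
  exact: (mS n [set A : {set 'I_k} | Y (s + #|A|)%N]).
have -> : [set w | outputs_within (phat w) thr i bound] =
    \bigcup_n (\bigcap_(m in [set m | (m < n)%N])
                 (S m @^-1` [set A : {set 'I_k} | (1 < #|A|)%N]) `&`
               (S n @^-1` [set [set i]%SET] `&`
               (fun w => \sum_(m < n) #|S m w|)%N @^-1`
                 [set s | s%:R <= bound])).
  apply/seteqP; split=> w [n]; first by case=> gt1 Sn le_bound; exists n.
  by move=> _ [gt1 [Sn le_bound]]; exists n.
apply: bigcupT_measurable => n; apply: measurableI; last exact: measurableI.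
by apply: bigcap_measurableType => m _.
Qed.

Lemma measurable_first_samples d (T : measurableType d) dO
    (O : measurableType dO) (X : nat -> T -> O) r :
  (forall s, measurable_fun setT (X s)) ->
  measurable_fun setT (first_samples X r).
Proof.
move=> mX; apply/measurable_fun_tnthP => i.
by rewrite (_ : _ \o _ = X i)//; apply: funext => w; rewrite /= tnth_mktuple.
Qed.

(** * The union bound over arms and rounds *)

Lemma probability_bigsetI_ge d (T : measurableType d) (R : realType)
    (P : probability T R) (I : Type) (s : seq I) (E : I -> set T) (b : I -> R) :
  (forall i, measurable (E i)) -> (forall i, ((1 - b i)%:E <= P (E i))%E) ->
  ((1 - \sum_(i <- s) b i)%:E <= P (\big[setI/setT]_(i <- s) E i))%E.
Proof.
move=> mE bE; elim: s => [|i s IHs].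
  by rewrite !big_nil subr0 probability_setT.
rewrite !big_cons; set F := \big[_/_]_(_ <- _) _ in IHs *.
have mF : measurable F by exact: bigsetI_measurable.
have : (P (~` E i `|` ~` F) <= P (~` E i) + P (~` F))%E.
  by apply: measureU2; exact: measurableC.
rewrite -setCI !probability_setC//; last exact: measurableI.
have mEF := measurableI _ _ (mE i) mF.
move: IHs (bE i).
rewrite -(fineK (fin_num_measure P _ (mE i))) -(fineK (fin_num_measure P _ mF)).
rewrite -(fineK (fin_num_measure P _ mEF)).
by rewrite -!EFinB -EFinD !lee_fin; lra.
Qed.

(** The [k] arms cancel [1 / k], and [\sum r^-2 <= pi^2 / 6] cancels [6 / pi^2]. Index [r < n]
    stands for round [r.+1]. *)
Lemma sum_round_level_le (R : realType) (k n : nat) (delta : R) :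
  (0 < k)%N -> 0 < delta ->
  \sum_(x : 'I_k * 'I_n) round_level k delta x.2.+1 <= delta.
Proof.
move=> k0 d0; have pi0 := @pi_gt0 R.
rewrite -(pair_bigA _ (fun _ (r : 'I_n) => round_level k delta r.+1))/=.
rewrite sumr_const card_ord.
have -> : \sum_(r < n) round_level k delta r.+1
    = 6 * delta / (pi ^+ 2 * k%:R) * \sum_(1 <= r < n.+1) (r%:R ^+ 2)^-1.
  rewrite big_add1/= big_mkord mulr_sumr; apply: eq_bigr => r _.
  by rewrite /round_level [in LHS]invfM mulrA.
rewrite -[leLHS]mulr_natl.
have scale (q b : R) : q != 0 -> b != 0 ->
    delta = b * (6 * delta / (q ^+ 2 * b) * (q ^+ 2 / 6)).
  by move=> q0 b0; field; rewrite q0 b0.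
apply: (@le_trans _ _ (k%:R * (6 * delta / (pi ^+ 2 * k%:R) * (pi ^+ 2 / 6)))).
  rewrite ler_pM2l ?ltr0n// ler_wpM2l ?sum_inv_sqr_le//.
  by rewrite divr_ge0 ?mulr_ge0 ?exprn_ge0 ?ler0n ?ltW.
by rewrite -scale ?lt0r_neq0 ?ltr0n.
Qed.

(** * From accurate estimates to the sample bounds *)

Lemma outputs_within_le (R : realType) (k : nat) (phat : 'I_k -> nat -> R)
    (thr : nat -> R) (i : 'I_k) (b1 b2 : R) : b1 <= b2 ->
  outputs_within phat thr i b1 -> outputs_within phat thr i b2.
Proof. by move=> b12 [n [gt1 Sn /le_trans/(_ b12) le_b2]]; exists n. Qed.

(** For [gap <= 1], [1 / gap^2 >= 1] and the logarithm is at least [ln 2 >= 1/2], so doubling the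
    complexity pays for the cap. *)
Lemma max1_arm_complexity_le (R : realType) (k : nat) (delta gap : R) :
  (2 <= k)%N -> 0 < delta < 1 -> 0 < gap <= 1 ->
  Num.max 1 (arm_complexity k delta gap) <= 2 * arm_complexity k delta gap.
Proof.
move=> k2 /andP[d0 d1] /andP[g0 g1].
have k2R : 2 <= k%:R :> R by rewrite ler_nat.
have dg0 : 0 < delta * gap by rewrite mulr_gt0.
have ln_ge : 1 / 2 <= ln (k%:R / (delta * gap)).
  apply: le_trans (ln2_ge_half R) _.
  have k0 : 0 < k%:R :> R := lt_le_trans (ltr0n R 2) k2R.
  rewrite ler_ln ?posrE ?divr_gt0// ler_pdivlMr//; apply: le_trans k2R.
  by have : delta * gap <= 1; [rewrite mulr_ile1// ltW|lra].
have inv_ge : 1 <= 1 / gap ^+ 2.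
  by rewrite ler_pdivlMr ?exprn_gt0// mul1r exprn_ile1// ltW.
have : 1 / 2 <= arm_complexity k delta gap.
  by rewrite /arm_complexity; nra.
by rewrite ge_max => h; apply/andP; split; lra.
Qed.

Theorem theorem3 (R : realType) (c : R) (hc : 0 < c) :
  exists C : R, 0 < C /\
  forall (k : nat) (hk : (2 <= k)%N)
    (dO : measure_display) (O : measurableType dO) (N : Type)
    (D : 'I_k -> R -> N -> probability O R)
    (p U : 'I_k -> R) (hU : forall i, 0 <= U i)
    (istar : 'I_k) (hopt : forall i, p i <= p istar)
    (hgap : forall i, i != istar -> 0 < effective_gap p U istar i)
    (delta : R) (hdelta : 0 < delta < 1)
    (est : 'I_k -> forall r : nat, {mfun r.-tuple O >-> R})
    (hest : forall (i : 'I_k) (r : nat), (1 <= r)%N ->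
       accurate_estimator (D i (p i)) (p i) (est i r)
         (U i + alpha c r (round_level k delta r)) (round_level k delta r))
    (d : measure_display) (T : measurableType d) (P : probability T R)
    (G : 'I_k -> nat -> N) (X : 'I_k -> nat -> {mfun T >-> O})
    (hX : forall i, independent_samples P (X i) (fun s => D i (p i) (G i s))),
  holds_with_probability P (1 - delta)
    (algorithm_event c delta est X istar
       (C * \sum_(i < k | i != istar)
              Num.max 1 (arm_complexity k delta (effective_gap p U istar i))))
  /\
  ((forall i, i != istar -> effective_gap p U istar i <= 1) ->
   holds_with_probability P (1 - delta)
     (algorithm_event c delta est X istar
        (C * \sum_(i < k | i != istar)
               arm_complexity k delta (effective_gap p U istar i)))).
Proof.
have [K K1 alphaK] := alpha_lt_gap hc; have K0 : 0 < K := lt_le_trans ltr01 K1.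
(* Three factors of two: the samples of [istar], the rounding in [tau], and, for the second claim,
   the removal of the cap. *)
exists (8 * K); split; first by rewrite mulr_gt0.
move=> k hk dO O N D p U hU istar hopt hgap delta hdelta est hest d T P G X hX.
pose gap i := effective_gap p U istar i.
pose M i := Num.max 1 (arm_complexity k delta (gap i)).
have M1 i : 1 <= M i by rewrite le_max lexx.
have phat_measurable i r :
    measurable_fun setT (fun w => est i r (first_samples (X i) r w)).
  apply: measurableT_comp => //.
  exact: measurable_first_samples.
suff main bound : 4 * K * \sum_(i < k | i != istar) M i <= bound ->
    holds_with_probability P (1 - delta)
      (algorithm_event c delta est X istar bound).
  split=> [|gap_le1]; apply: main.
    by rewrite ler_wpM2r ?sumr_ge0// => [i _|];
      [exact: le_trans ler01 (M1 i)|lra].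
  rewrite (_ : 8 * K = 4 * K * 2); last by ring.
  rewrite -[leRHS]mulrA ler_pM2l ?mulr_gt0// mulr_sumr;
    apply: ler_sum => i iistar.
  by apply: max1_arm_complexity_le => //; rewrite hgap ?gap_le1.
move=> le_bound.
have mevent : measurable (algorithm_event c delta est X istar bound).
  exact: (measurable_outputs_within
    (phat := fun w i r => est i r (first_samples (X i) r w))).
split=> //.
(* Rounds up [K * M i], so that [alphaK] applies; as [K * M i >= 1], this at most doubles it. *)
pose tau i := (Num.truncn (K * M i)).+1.
pose n0 := \max_i tau i.
pose a r := alpha c r (round_level k delta r).
pose E (x : 'I_k * 'I_n0) : set T :=
  [set w | `|est x.1 x.2.+1 (first_samples (X x.1) x.2.+1 w) - p x.1|
           <= U x.1 + a x.2.+1].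
have tau_lt i : K * M i <= (tau i)%:R <= 2 * K * M i.
  have KM0 : 1 <= K * M i by rewrite mulr_ege1.
  have /andP[lo hi] := truncn_itv (le_trans ler01 KM0).
  by rewrite ltW//= /tau -natr1; lra.
have mE x : measurable (E x).
  rewrite -[X in measurable X]setTI.
  have mf : measurable_fun setT
      (fun w => `|est x.1 x.2.+1 (first_samples (X x.1) x.2.+1 w) - p x.1|).
    apply: measurableT_comp => //; apply: measurable_funB => //.
  have /(_ measurableT [set true] I) :=
    measurable_fun_ler mf (measurable_cst (U x.1 + a x.2.+1)).
  exact.
have PE (x : 'I_k * 'I_n0) : ((1 - round_level k delta x.2.+1)%:E <= P (E x))%E.
  exact: (hest x.1 x.2.+1 isT _ _ _ _ _ (hX x.1)).
have Pgood := probability_bigsetI_ge (index_enum _) mE PE.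
apply: (@le_trans _ _ (P (\big[setI/setT]_x E x))); last first.
  apply: le_measure; rewrite ?inE//; first exact: bigsetI_measurable.
  move=> w good; apply: outputs_within_le le_bound _.
  apply: (@outputs_within_le _ _ _ _ _
    (2 * \sum_(i < k | i != istar) (tau i)%:R)).
    rewrite (_ : 4 * K = 2 * (2 * K)); last by ring.
    rewrite -mulrA ler_pM2l// mulr_sumr; apply: ler_sum => i _.
    by have /andP[] := tau_lt i.
  apply: (outputs_within_accurate (p := p) (U := U) (n0 := n0)) => //.
  - by move=> r; exact: sqrtr_ge0.
  - by move=> i /=; exact: leq_bigmax.
  - move=> i iistar; apply: (alphaK _ _ _ _ hk hdelta (hgap _ iistar)).
    by have /andP[] := tau_lt i.
  - move=> i r /andP[r0 rn0].
    have rn0' : (r.-1 < n0)%N by rewrite prednK.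
    have := good; rewrite -bigcap_seq => /(_ (i, Ordinal rn0')).
    by rewrite /E/= prednK//; apply; rewrite mem_index_enum.
apply: le_trans Pgood; rewrite lee_fin lerD2l lerN2.
by apply: sum_round_level_le; [exact: ltnW|case/andP: hdelta].
Qed.
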